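(* The following categories satisfy axioms (A1)–(A6): (a) the category of pointed objects of an elementary topos; (b) the full subcategory of inhabited objects of a nondegenerate two-valued elementary topos.
   Context: AXIOMS (for a category $\mathcal C$, not necessarily small). A monomorphism $m:A\to B$ is strong if for every epimorphism $e:P\to Q$ and all $a:P\to A$, $b:Q\to B$ with $ma=be$ there is $\ell:Q\to A$ with $\ell e=a$ and $m\ell=b$. (A1) There is a terminal object $1$; $q_X:X\to 1$ is the unique morphism, and a point of $Y$ is a morphism $1\to Y$ in $\mathcal C$. (A2) Every morphism factors as $me$ with $e$ an epimorphism and $m$ a strong monomorphism. (A3) For every epimorphism $d:X\to Y$ and strong monomorphism $v:B\to Y$ the pullback of $d$ and $v$ exists and its projection to $B$ is an epimorphism. (A4) For every strong monomorphism $u:A\to X$ and epimorphism $a:A\to B$ there is a pushout square $cu=va$ ($c:X\to Y$, $v:B\to Y$) with $v$ a strong monomorphism, and this square is also a pullback. (A5) The class of epimorphisms whose pullbacks along all but at most one point of their codomain are isomorphisms is stable under pushout along strong monomorphisms. (The pullback of $d:X\to Y$ along a point $1\to Y$ is the projection $X\times_Y1\to1$.) (A6) For every object $A$ and point $j:1\to B$ the following category has a terminal object: objects are triples $(C,d,u)$ with $u:A\to C$ a strong monomorphism and $d:C\to B$ an epimorphism such that the square $du=jq_A$ is a pullback; morphisms $(C',d',u')\to(C,d,u)$ are morphisms $h:C'\to C$ with $hu'=u$ and $dh=d'$. DEFINITIONS. An elementary topos is a category with finite limits, exponential objects and a subobject classifier. An object $X$ is inhabited if $X\to1$ is epic. A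 topos is two-valued if the only subobjects of $1$ are $0$ and $1$, and nondegenerate if these are distinct. A pointed object is an object $X$ with a specified morphism $x:1\to X$; morphisms of pointed objects preserve the specified points. *)

(* Defs.v *)
From Stdlib Require Import Classical_Prop FinFun.

Set Implicit Arguments.
Unset Strict Implicit.
Unset Printing Implicit Defensive.

Declare Scope cat_scope.
Delimit Scope cat_scope with cat.
Local Open Scope cat_scope.

(* Neither objects nor morphisms are required to form a small type; equality of
   morphisms is Leibniz equality. *)
Record Category := {
  Ob :> Type;
  Hom : Ob -> Ob -> Type;
  idm : forall X, Hom X X;
  comp : forall X Y Z, Hom Y Z -> Hom X Y -> Hom X Z;
  comp_idl : forall X Y (f : Hom X Y), comp (idm Y) f = f;
  comp_idr : forall X Y (f : Hom X Y), comp f (idm X) = f;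
  comp_assoc : forall W X Y Z (h : Hom Y Z) (g : Hom X Y) (f : Hom W X),
      comp h (comp g f) = comp (comp h g) f
}.

Arguments Hom {c} X Y.
Arguments idm {c} X.
Arguments comp {c X Y Z} g f.

Notation "X ~> Y" := (Hom X Y) (at level 90, right associativity) : cat_scope.
Notation "g ∘ f" := (comp g f) (at level 40, left associativity) : cat_scope.

Section Basic.
Variable C : Category.

Definition is_iso (X Y : C) (f : X ~> Y) : Prop :=
  exists g : Y ~> X, g ∘ f = idm X /\ f ∘ g = idm Y.

Definition monic (X Y : C) (m : X ~> Y) : Prop :=
  forall (W : C) (f g : W ~> X), m ∘ f = m ∘ g -> f = g.

Definition epic (X Y : C) (e : X ~> Y) : Prop :=
  forall (Z : C) (f g : Y ~> Z), f ∘ e = g ∘ e -> f = g.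

Definition strong_monic (A B : C) (m : A ~> B) : Prop :=
  monic m /\
  forall (P Q : C) (e : P ~> Q), epic e ->
  forall (a : P ~> A) (b : Q ~> B), m ∘ a = b ∘ e ->
  exists l : Q ~> A, l ∘ e = a /\ m ∘ l = b.

(*  P --q--> B
    |        |
    p        g
    v        v
    A --f--> Z   *)
Definition is_pullback (P A B Z : C)
    (f : A ~> Z) (g : B ~> Z) (p : P ~> A) (q : P ~> B) : Prop :=
  f ∘ p = g ∘ q /\
  forall (W : C) (a : W ~> A) (b : W ~> B), f ∘ a = g ∘ b ->
  exists! h : W ~> P, p ∘ h = a /\ q ∘ h = b.

(*  S --g--> B
    |        |
    f        q
    v        v
    A --p--> P   *)
Definition is_pushout (S A B P : C)
    (f : S ~> A) (g : S ~> B) (p : A ~> P) (q : B ~> P) : Prop :=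
  p ∘ f = q ∘ g /\
  forall (W : C) (a : A ~> W) (b : B ~> W), a ∘ f = b ∘ g ->
  exists! h : P ~> W, h ∘ p = a /\ h ∘ q = b.

Definition is_product (A B P : C) (p : P ~> A) (q : P ~> B) : Prop :=
  forall (W : C) (a : W ~> A) (b : W ~> B),
  exists! h : W ~> P, p ∘ h = a /\ q ∘ h = b.

Record Terminal := {
  one :> C;
  bang : forall X : C, X ~> one;
  bang_unique : forall (X : C) (f : X ~> one), f = bang X
}.

Record Initial := {
  zero :> C;
  cobang : forall X : C, zero ~> X;
  cobang_unique : forall (X : C) (f : zero ~> X), f = cobang X
}.

(* Equality of the subobjects represented by two monomorphisms. *)
Definition same_subobject (A B X : C) (m : A ~> X) (n : B ~> X) : Prop :=
  exists i : A ~> B, is_iso i /\ n ∘ i = m.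

End Basic.

Section Factorizations.
Variables (C : Category) (T : Terminal C) (A B : C) (j : T ~> B).

Record fact_ob := {
  fact_mid : C;
  fact_epi : fact_mid ~> B;
  fact_mono : A ~> fact_mid;
  fact_monoP : strong_monic fact_mono;
  fact_epiP : epic fact_epi;
  fact_pb : is_pullback fact_epi j fact_mono (bang T A)
}.

Definition fact_hom (X Y : fact_ob) : Type :=
  { h : fact_mid X ~> fact_mid Y |
    h ∘ fact_mono X = fact_mono Y /\ fact_epi Y ∘ h = fact_epi X }.

Lemma fact_idP (X : fact_ob) :
  idm (fact_mid X) ∘ fact_mono X = fact_mono X /\
  fact_epi X ∘ idm (fact_mid X) = fact_epi X.
Proof. split; [apply comp_idl | apply comp_idr]. Qed.

Definition fact_id (X : fact_ob) : fact_hom X X := exist _ _ (fact_idP X).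

Lemma fact_compP (X Y Z : fact_ob) (g : fact_hom Y Z) (f : fact_hom X Y) :
  (proj1_sig g ∘ proj1_sig f) ∘ fact_mono X = fact_mono Z /\
  fact_epi Z ∘ (proj1_sig g ∘ proj1_sig f) = fact_epi X.
Proof.
destruct g as [g [g1 g2]], f as [f [f1 f2]]; simpl; split.
- now rewrite <- comp_assoc, f1.
- now rewrite comp_assoc, g2.
Qed.

Definition fact_comp (X Y Z : fact_ob) (g : fact_hom Y Z) (f : fact_hom X Y) :
  fact_hom X Z := exist _ _ (fact_compP g f).

Definition fact_cat : Category.
Proof.
refine (@Build_Category fact_ob fact_hom fact_id fact_comp _ _ _);
  intros; apply eq_sig_hprop; simpl; try (intros; apply proof_irrelevance).
- apply comp_idl.
- apply comp_idr.
- apply comp_assoc.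
Defined.

End Factorizations.

Section Conditions.
Variable C : Category.

Definition axiom_A1 : Prop := inhabited (Terminal C).

Definition axiom_A2 : Prop :=
  forall (X Y : C) (f : X ~> Y),
  exists (I : C) (e : X ~> I) (m : I ~> Y),
    epic e /\ strong_monic m /\ f = m ∘ e.

Definition axiom_A3 : Prop :=
  forall (X Y B : C) (d : X ~> Y) (v : B ~> Y), epic d -> strong_monic v ->
  exists (P : C) (p : P ~> X) (q : P ~> B), is_pullback d v p q /\ epic q.

Definition axiom_A4 : Prop :=
  forall (A X B : C) (u : A ~> X) (a : A ~> B), strong_monic u -> epic a ->
  exists (Y : C) (c : X ~> Y) (v : B ~> Y),
    is_pushout u a c v /\ strong_monic v /\ is_pullback c v u a.

Definition iso_over_point (T : Terminal C) (X Y : C) (d : X ~> Y) (y : T ~> Y)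
  : Prop :=
  exists (F : C) (p : F ~> X) (q : F ~> T), is_pullback d y p q /\ is_iso q.

Definition epic_iso_but_one (T : Terminal C) (X Y : C) (d : X ~> Y) : Prop :=
  epic d /\
  forall y1 y2 : T ~> Y,
    ~ iso_over_point d y1 -> ~ iso_over_point d y2 -> y1 = y2.

Definition axiom_A5 (T : Terminal C) : Prop :=
  forall (X Y Z W : C) (d : X ~> Y) (u : X ~> Z) (d' : Z ~> W) (u' : Y ~> W),
    epic_iso_but_one T d -> strong_monic u -> is_pushout d u u' d' ->
    epic_iso_but_one T d'.

Definition axiom_A6 (T : Terminal C) : Prop :=
  forall (A B : C) (j : T ~> B), inhabited (Terminal (fact_cat A j)).

(* The last two axioms mention the terminal object provided by the first; they
   are required for every choice of it. *)
Record satisfies_axioms : Prop := {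
  sat_A1 : axiom_A1;
  sat_A2 : axiom_A2;
  sat_A3 : axiom_A3;
  sat_A4 : axiom_A4;
  sat_A5 : forall T : Terminal C, axiom_A5 T;
  sat_A6 : forall T : Terminal C, axiom_A6 T
}.

End Conditions.

Record Functor (J C : Category) := {
  fob :> J -> C;
  fmap : forall i j : J, (i ~> j) -> (fob i ~> fob j);
  fmap_id : forall i : J, fmap (idm i) = idm (fob i);
  fmap_comp : forall (i j k : J) (g : j ~> k) (f : i ~> j),
      fmap (g ∘ f) = fmap g ∘ fmap f
}.

Definition finite_category (J : Category) : Prop :=
  Finite J /\ forall i j : J, Finite (i ~> j).

Definition is_cone (J C : Category) (F : Functor J C)
    (X : C) (phi : forall j : J, X ~> F j) : Prop :=
  forall (i j : J) (f : i ~> j), fmap F f ∘ phi i = phi j.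

Definition is_limit (J C : Category) (F : Functor J C)
    (L : C) (pr : forall j : J, L ~> F j) : Prop :=
  is_cone pr /\
  forall (X : C) (phi : forall j : J, X ~> F j), is_cone phi ->
  exists! h : X ~> L, forall j : J, pr j ∘ h = phi j.

Section Topos.
Variable C : Category.

Definition has_finite_limits : Prop :=
  forall J : Category, finite_category J -> forall F : Functor J C,
  exists (L : C) (pr : forall j : J, L ~> F j), is_limit pr.

(* [ev], defined on a product of [E] and [A], exhibits [E] as the exponential
   [B^A]; in the universal property [h] is the morphism [g * id_A]. *)
Definition is_exponential (A B E P : C)
    (p : P ~> E) (q : P ~> A) (ev : P ~> B) : Prop :=
  is_product p q /\
  forall (X Q : C) (p' : Q ~> X) (q' : Q ~> A), is_product p' q' ->
  forall f : Q ~> B,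
  exists! g : X ~> E,
    exists h : Q ~> P, p ∘ h = g ∘ p' /\ q ∘ h = q' /\ ev ∘ h = f.

Definition has_exponentials : Prop :=
  forall A B : C, exists (E P : C) (p : P ~> E) (q : P ~> A) (ev : P ~> B),
    is_exponential p q ev.

Definition has_subobject_classifier : Prop :=
  exists (T : Terminal C) (Omega : C) (tr : T ~> Omega),
  forall (A X : C) (m : A ~> X), monic m ->
  exists! chi : X ~> Omega, is_pullback chi tr m (bang T A).

Record elementary_topos : Prop := {
  topos_limits : has_finite_limits;
  topos_exponentials : has_exponentials;
  topos_classifier : has_subobject_classifier
}.

Definition inhabited_object (X : C) : Prop :=
  exists T : Terminal C, epic (bang T X).

(* In a topos both 0 and 1 exist and are unique up to unique isomorphism, so
   quantifying over all choices of them in the next two definitions is harmless;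
   the subobjects 0 and 1 of 1 are [cobang Z T] and [idm T]. *)
Definition two_valued : Prop :=
  forall (T : Terminal C) (Z : Initial C) (U : C) (m : U ~> T), monic m ->
    same_subobject m (cobang Z T) \/ same_subobject m (idm T).

Definition nondegenerate : Prop :=
  forall (T : Terminal C) (Z : Initial C),
    ~ same_subobject (cobang Z T) (idm T).

End Topos.

Definition full_subcategory (C : Category) (P : C -> Prop) : Category :=
  {| Ob := { X : C | P X };
     Hom X Y := proj1_sig X ~> proj1_sig Y;
     idm X := idm (proj1_sig X);
     comp X Y Z g f := g ∘ f;
     comp_idl X Y f := comp_idl f;
     comp_idr X Y f := comp_idr f;
     comp_assoc W X Y Z h g f := comp_assoc h g f |}.

Section Pointed.
Variables (C : Category) (T : Terminal C).

Record pointed_ob := {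
  pcarrier : C;
  ppoint : T ~> pcarrier
}.

Definition pointed_hom (X Y : pointed_ob) : Type :=
  { f : pcarrier X ~> pcarrier Y | f ∘ ppoint X = ppoint Y }.

Definition pointed_id (X : pointed_ob) : pointed_hom X X :=
  exist _ (idm (pcarrier X)) (comp_idl (ppoint X)).

Lemma pointed_compP (X Y Z : pointed_ob)
    (g : pointed_hom Y Z) (f : pointed_hom X Y) :
  (proj1_sig g ∘ proj1_sig f) ∘ ppoint X = ppoint Z.
Proof.
destruct g as [g gP], f as [f fP]; simpl.
now rewrite <- comp_assoc, fP.
Qed.

Definition pointed_comp (X Y Z : pointed_ob)
    (g : pointed_hom Y Z) (f : pointed_hom X Y) : pointed_hom X Z :=
  exist _ _ (pointed_compP g f).

Definition pointed_category : Category.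
Proof.
refine (@Build_Category pointed_ob pointed_hom pointed_id pointed_comp _ _ _);
  intros; apply eq_sig_hprop; simpl; try (intros; apply proof_irrelevance).
- apply comp_idl.
- apply comp_idr.
- apply comp_assoc.
Defined.

End Pointed.

(* Main.v *)
(* Everything is deduced from pullbacks and power objects, by comparing maps
   into powers through their memberships at generalized elements. Monomorphisms
   are classified, hence strong, and images and pushouts along epimorphisms
   are constructed inside double powers. For (A6), the middle object consists of
   the pairs (b, S) with S a partial element of A defined exactly where b = j.

   Both categories of the theorem are categories of elements of a functor F from
   the topos to sets: F = Hom(1, -) for pointed objects, and F X = {* | X is
   inhabited} for inhabited ones. So epimorphisms, monomorphisms, pullbacks and
   pushouts in them are computed in the topos. For (A5), a point of the pushout
   either comes from a point of Y, with the same fibre, or is disjoint from Y,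
   and then its fibre is a subobject of 1 that covers 1. This dichotomy is trivial
   for pointed objects and is two-valuedness for inhabited ones. *)

From Stdlib Require Import ssreflect Classical_Prop IndefiniteDescription.
Require Import Defs.

Set Implicit Arguments.
Unset Strict Implicit.
Unset Printing Implicit Defensive.

Local Open Scope cat_scope.

(** Choice: objects that merely exist for each index, such as power objects or cobangs, are gathered
    into a function. *)
Lemma inhabited_forall (A : Type) (B : A -> Type) :
  (forall x, inhabited (B x)) -> inhabited (forall x, B x).
Proof.
move=> H; have H' x : exists y : B x, True by case: (H x) => y; exists y.
constructor=> x.
exact: (proj1_sig (constructive_indefinite_description _ (H' x))).
Qed.

(** * Pullbacks, pushouts, monomorphisms and epimorphisms in any category *)

Section Diagrams.
Variable C : Category.

Lemma comp_eq2 (X Y Z : C) (f : Y ~> Z) (g : X ~> Y) (h : X ~> Z) :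
  f ∘ g = h -> forall (W : C) (t : W ~> X), f ∘ (g ∘ t) = h ∘ t.
Proof. by move=> <- W t; rewrite comp_assoc. Qed.

Lemma comp_eq3 (W X Y Z : C) (f : Y ~> Z) (g : X ~> Y) (h : W ~> X)
    (k : W ~> Z) :
  f ∘ (g ∘ h) = k -> forall (V : C) (t : V ~> W), f ∘ (g ∘ (h ∘ t)) = k ∘ t.
Proof. by move=> <- V t; rewrite !comp_assoc. Qed.

Definition jointly_monic (R A B : C) (p : R ~> A) (q : R ~> B) : Prop :=
  forall (W : C) (h h' : W ~> R), p ∘ h = p ∘ h' -> q ∘ h = q ∘ h' -> h = h'.

Definition has_pullbacks : Prop :=
  forall (A B Z : C) (f : A ~> Z) (g : B ~> Z),
  exists (P : C) (p : P ~> A) (q : P ~> B), is_pullback f g p q.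

End Diagrams.

(* Rewrites with [H : f ∘ g = h] (or [f ∘ (g ∘ h) = k]) modulo associativity. *)
Ltac norm := rewrite -?comp_assoc ?comp_idl ?comp_idr.
Ltac crw H :=
  let E := fresh "E" in
  pose proof H as E; rewrite -?comp_assoc ?comp_idl ?comp_idr in E;
  norm; first [rewrite !(comp_eq3 E) | rewrite !(comp_eq2 E) | rewrite !E]; norm;
  clear E.

Section Pullbacks.
Variable C : Category.

Lemma pullback_lift (P A B Z : C) (f : A ~> Z) (g : B ~> Z) (p : P ~> A)
    (q : P ~> B) : is_pullback f g p q ->
  forall (W : C) (a : W ~> A) (b : W ~> B), f ∘ a = g ∘ b ->
  exists h : W ~> P, p ∘ h = a /\ q ∘ h = b.
Proof. by move=> [_ H] W a b /H [h [hP _]]; exists h. Qed.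

Lemma pullback_joint (P A B Z : C) (f : A ~> Z) (g : B ~> Z) (p : P ~> A)
    (q : P ~> B) : is_pullback f g p q -> jointly_monic p q.
Proof.
move=> [sq H] W h h' ph qh.
have [k [_ kU]] := H W (p ∘ h') (q ∘ h')
  (eq_trans (comp_assoc _ _ _) (eq_trans (f_equal (fun z => z ∘ h') sq)
     (eq_sym (comp_assoc _ _ _)))).
by rewrite -(kU h) // -(kU h').
Qed.

Lemma pullbackI (P A B Z : C) (f : A ~> Z) (g : B ~> Z) (p : P ~> A)
    (q : P ~> B) :
  f ∘ p = g ∘ q -> jointly_monic p q ->
  (forall (W : C) (a : W ~> A) (b : W ~> B), f ∘ a = g ∘ b ->
   exists h : W ~> P, p ∘ h = a /\ q ∘ h = b) ->
  is_pullback f g p q.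
Proof.
move=> sq jm H; split=> // W a b /H [h [ha hb]]; exists h; split=> //.
by move=> h' [ha' hb']; apply: jm; congruence.
Qed.

Lemma pullback_sym (P A B Z : C) (f : A ~> Z) (g : B ~> Z) (p : P ~> A)
    (q : P ~> B) : is_pullback f g p q -> is_pullback g f q p.
Proof.
move=> H; apply: pullbackI; first by case: H.
- by move=> W h h' e1 e2; apply: (pullback_joint H).
- move=> W a b e; have [h [ha hb]] := pullback_lift H (eq_sym e).
  by exists h.
Qed.

Lemma product_joint (Q A B : C) (p : Q ~> A) (q : Q ~> B) :
  is_product p q -> jointly_monic p q.
Proof.
move=> H W h h' e1 e2; have [k [_ kU]] := H _ (p ∘ h') (q ∘ h').
by rewrite -(kU h) // -(kU h').
Qed.

Lemma monic_pullback (P A B Z : C) (f : A ~> Z) (g : B ~> Z) (p : P ~> A)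
    (q : P ~> B) : is_pullback f g p q -> monic g -> monic p.
Proof.
move=> H mg W h h' e; apply: (pullback_joint H) => //; apply: mg.
by case: H => sq _; rewrite !comp_assoc -sq -!comp_assoc e.
Qed.

(** Serves (A5): a fibre of [d] over [y] is also the fibre of [d'] over [u' ∘ y]. *)
Lemma pullback_paste (F X Y Z W V : C) (d : X ~> Y) (u : X ~> Z) (u' : Y ~> W)
    (d' : Z ~> W) (y : V ~> Y) (p : F ~> X) (q : F ~> V) :
  is_pullback d' u' u d -> is_pullback d y p q ->
  is_pullback d' (u' ∘ y) (u ∘ p) q.
Proof.
move=> H K; case: (H) => sq _; case: (K) => sq' _; apply: pullbackI.
- by crw sq; crw sq'.
- move=> S h h' e1 e2; apply: (pullback_joint K) => //.
  apply: (pullback_joint H); first by rewrite !comp_assoc.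
  by crw sq'; rewrite e2.
- move=> S a b e.
  have [x [xa xb]] := pullback_lift H (eq_trans e (eq_sym (comp_assoc _ _ _))).
  have [h [hx hb]] := pullback_lift K xb.
  by exists h; split=> //; crw hx.
Qed.

Lemma pushout_sym (S A B Q : C) (f : S ~> A) (g : S ~> B) (p : A ~> Q)
    (q : B ~> Q) : is_pushout f g p q -> is_pushout g f q p.
Proof.
move=> [sq H]; split=> // W a b e; have [h [[h1 h2] hU]] := H _ b a (eq_sym e).
by exists h; split=> // k [k1 k2]; apply: hU.
Qed.

Lemma pushout_epic (S A B Q : C) (f : S ~> A) (g : S ~> B) (p : A ~> Q)
    (q : B ~> Q) : is_pushout f g p q -> epic f -> epic q.
Proof.
move=> [sq H] ef W a b e; have [|h [_ hU]] := H W (b ∘ p) (b ∘ q).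
  by rewrite -!comp_assoc sq.
rewrite -(hU a) ?(hU b) //; split=> //; apply: ef.
by norm; rewrite sq !comp_assoc e.
Qed.

Lemma split_monic (A B : C) (m : A ~> B) (r : B ~> A) : r ∘ m = idm A -> monic m.
Proof.
by move=> H W f g e; rewrite -(comp_idl f) -(comp_idl g) -H; norm; rewrite e.
Qed.

Lemma monic_comp (X Y Z : C) (m : X ~> Y) (n : Y ~> Z) :
  monic m -> monic n -> monic (n ∘ m).
Proof. by move=> mm mn W f g; norm; move/mn/mm. Qed.

Lemma epic_comp (X Y Z : C) (m : X ~> Y) (n : Y ~> Z) :
  epic m -> epic n -> epic (n ∘ m).
Proof. by move=> mm mn W f g; rewrite !comp_assoc; move/mm/mn. Qed.

Lemma epic_cancel (X Y Z : C) (m : X ~> Y) (n : Y ~> Z) :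
  epic (n ∘ m) -> epic n.
Proof.
by move=> e W f g H; apply: e; rewrite !comp_assoc H.
Qed.

Lemma terminal_eq (T : Terminal C) (X : C) (f g : X ~> T) : f = g.
Proof. by rewrite (bang_unique f) (bang_unique g). Qed.

Lemma point_monic (T : Terminal C) (X : C) (x : T ~> X) : monic x.
Proof. by move=> W f g _; apply: terminal_eq. Qed.

End Pullbacks.

(** * Power objects *)

Section Powers.
Variable C : Category.

(** Relations are jointly monic spans, and the classifying property is tested on generalized
    elements, so no products enter. *)
Record power_object (X : C) := {
  Pw : C;
  El : C;
  el1 : El ~> Pw;
  el2 : El ~> X;
  el_joint : jointly_monic el1 el2;
  el_classify : forall (W R : C) (r1 : R ~> W) (r2 : R ~> X),
    jointly_monic r1 r2 ->
    exists! k : W ~> Pw, forall (V : C) (w : V ~> W) (x : V ~> X),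
      (exists s, el1 ∘ s = k ∘ w /\ el2 ∘ s = x) <->
      (exists s, r1 ∘ s = w /\ r2 ∘ s = x)
}.

Variables (T : Terminal C) (pb : has_pullbacks C)
  (pow : forall X : C, power_object X).

Definition power (X : C) : C := Pw (pow X).

Definition mem (X V : C) (k : V ~> power X) (x : V ~> X) : Prop :=
  exists s : V ~> El (pow X), el1 _ ∘ s = k /\ el2 _ ∘ s = x.

Lemma binary_product (A B : C) :
  exists (Q : C) (p : Q ~> A) (q : Q ~> B), is_product p q.
Proof.
have [Q [p [q H]]] := pb (bang T A) (bang T B).
by exists Q, p, q => W a b; case: H => _; apply; apply: terminal_eq.
Qed.

(** The pullback of the graphs [a] of [f] and [b] of [g] inside the product of [A] and [B]. *)
Lemma equalizer (A B : C) (f g : A ~> B) :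
  exists (E : C) (m : E ~> A), monic m /\ f ∘ m = g ∘ m /\
  forall (V : C) (t : V ~> A), f ∘ t = g ∘ t -> exists s, m ∘ s = t.
Proof.
have [Q [p [q H]]] := binary_product A B.
have jm := product_joint H.
have [a [[a1 a2] _]] := H _ (idm A) f.
have [b [[b1 b2] _]] := H _ (idm A) g.
have [E [m [m' K]]] := pb a b.
have sq : a ∘ m = b ∘ m' by case: K.
have em : m = m' by rewrite -[m]comp_idl -[m']comp_idl -{1}a1 -b1; norm; rewrite sq.
subst m'; exists E, m; split; last split.
- by move=> W h h' e; apply: (pullback_joint K).
- by rewrite -a2 -b2; norm; rewrite sq.
- move=> V t e; have [] := @pullback_lift _ _ _ _ _ _ _ _ _ K V t t.
    by apply: jm; [crw a1; crw b1 | crw a2; crw b2].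
  by move=> h [h1 _]; exists h.
Qed.

(** * Calculus of membership at generalized elements *)

Lemma mem_repr (W X : C) (k : W ~> power X) :
  exists (R : C) (r1 : R ~> W) (r2 : R ~> X), jointly_monic r1 r2 /\
  forall (V : C) (w : V ~> W) (x : V ~> X),
    mem (k ∘ w) x <-> exists s, r1 ∘ s = w /\ r2 ∘ s = x.
Proof.
have [R [p [q H]]] := pb (el1 (pow X)) k.
have sq : el1 _ ∘ p = k ∘ q by case: H.
exists R, q, (el2 _ ∘ p); split.
  move=> V h h' e1 e2; apply: (pullback_joint H) => //.
  apply: el_joint; last by rewrite !comp_assoc.
  by crw sq; rewrite e1.
move=> V w x; split.
- move=> [s [s1 s2]]; have [h [h1 h2]] := pullback_lift H s1.
  by exists h; split=> //; crw h1.
- move=> [s [<- <-]]; exists (p ∘ s); norm; split=> //.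
  by rewrite !comp_assoc sq.
Qed.

Lemma mem_classify (W R X : C) (r1 : R ~> W) (r2 : R ~> X) :
  jointly_monic r1 r2 ->
  exists k : W ~> power X, forall (V : C) (w : V ~> W) (x : V ~> X),
    mem (k ∘ w) x <-> exists s, r1 ∘ s = w /\ r2 ∘ s = x.
Proof. by move=> /(el_classify (pow X)) [k [H _]]; exists k. Qed.

Lemma mem_ext (W X : C) (k k' : W ~> power X) :
  (forall (V : C) (w : V ~> W) (x : V ~> X), mem (k ∘ w) x <-> mem (k' ∘ w) x) ->
  k = k'.
Proof.
move=> E; have [R [r1 [r2 [jm H]]]] := mem_repr k.
have [c [_ cU]] := el_classify (pow X) jm.
rewrite -(cU k) //; apply: cU => V w x.
by rewrite -(H V w x) (E V w x).
Qed.

(** The classified relation is the membership relation of [Y] pulled back along [f]. *)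
Lemma preimage (X Y : C) (f : X ~> Y) :
  exists F : power Y ~> power X, forall (V : C) (k : V ~> power Y) (x : V ~> X),
    mem (F ∘ k) x <-> mem k (f ∘ x).
Proof.
have [R [r1 [r2 [jm H]]]] := mem_repr (idm (power Y)).
have [S [p [q K]]] := pb r2 f.
have [sq _] := K.
have [|F FP] := @mem_classify _ _ _ (r1 ∘ p) q.
  move=> V h h' e1 e2; apply: (pullback_joint K) => //.
  apply: jm; first by rewrite !comp_assoc.
  by crw sq; rewrite e2.
exists F => V k x; rewrite FP -{2}(comp_idl k) H; split.
- move=> [s [<- <-]]; exists (p ∘ s); norm; split=> //.
  by rewrite !comp_assoc sq.
- move=> [s [s1 s2]]; have [h [h1 h2]] := pullback_lift K s2.
  by exists h; split=> //; crw h1.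
Qed.

Lemma transpose (W X : C) (k : W ~> power X) :
  exists k' : X ~> power W, forall (V : C) (w : V ~> W) (x : V ~> X),
    mem (k' ∘ x) w <-> mem (k ∘ w) x.
Proof.
have [R [r1 [r2 [jm H]]]] := mem_repr k.
have [|k' kP] := @mem_classify _ _ _ r2 r1.
  by move=> V h h' e1 e2; apply: jm.
exists k' => V w x; rewrite kP H.
by split=> -[s [s1 s2]]; exists s.
Qed.

(** The span is a partial map from [X] to [B] with domain [u]; [k] encodes it by subsets of [B] with
    at most one element. *)
Lemma graph (A X B : C) (u : A ~> X) (a : A ~> B) : monic u ->
  exists k : X ~> power B, forall (V : C) (x : V ~> X) (b : V ~> B),
    mem (k ∘ x) b <-> exists s, u ∘ s = x /\ a ∘ s = b.
Proof. by move=> mu; apply: mem_classify => V h h' /mu. Qed.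

Lemma singleton (X : C) :
  exists k : X ~> power X, monic k /\ forall (V : C) (x y : V ~> X),
    mem (k ∘ x) y <-> x = y.
Proof.
have [|k kP] := @graph _ _ _ (idm X) (idm X).
  by move=> V f g; rewrite !comp_idl.
have kP' V (x y : V ~> X) : mem (k ∘ x) y <-> x = y.
  rewrite kP; split; first by move=> [s [<- <-]].
  by move=> ->; exists y; rewrite comp_idl.
exists k; split=> // V f g e.
by apply/kP'; rewrite e; apply/kP'.
Qed.

(** [power T] plays the object of truth values: a subset of [T] is true where it has an element. *)
Lemma characteristic (A X : C) (m : A ~> X) : monic m ->
  exists k : X ~> power T, forall (V : C) (x : V ~> X) (b : V ~> T),
    mem (k ∘ x) b <-> exists s, m ∘ s = x.
Proof.
move=> mm; have [k kP] := graph (bang T A) mm.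
exists k => V x b; rewrite kP; split; first by move=> [s [? _]]; exists s.
by move=> [s ?]; exists s; split=> //; apply: terminal_eq.
Qed.

Lemma name (A X : C) (m : A ~> X) : monic m ->
  exists k : T ~> power X, forall (V : C) (b : V ~> T) (x : V ~> X),
    mem (k ∘ b) x <-> exists s, m ∘ s = x.
Proof.
move=> /characteristic [k kP]; have [k' kP'] := transpose k.
by exists k' => V b x; rewrite kP' kP.
Qed.

(** Subobjects of [Y] with the same preimage along [d] have characteristic maps that agree after
    [d], hence are equal. *)
Lemma epic_subobject (X Y A B : C) (d : X ~> Y) (m : A ~> Y) (n : B ~> Y) :
  epic d -> monic m -> monic n ->
  (forall (V : C) (t : V ~> X),
     (exists s, m ∘ s = d ∘ t) <-> (exists s, n ∘ s = d ∘ t)) ->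
  exists r, n ∘ r = m.
Proof.
move=> ed /characteristic [k kP] /characteristic [k' kP'] H.
have e : k = k' by apply: ed; apply: mem_ext => V w x; norm; rewrite kP kP'.
apply/(kP' _ _ (bang T A)); rewrite -e; apply/kP.
by exists (idm A); rewrite comp_idr.
Qed.

(** Pull [m] back along [b] to [q]. Since [e] factors through [q], the subobject [q] and the whole
    of [Q] have the same preimage along [e], so [q] has a section [r], which gives the diagonal. *)
Lemma monic_strong (A B : C) (m : A ~> B) : monic m -> strong_monic m.
Proof.
move=> mm; split=> // Q' Q e ee a b sq.
have [D [p [q K]]] := pb m b.
have [sqK _] := K.
have mq : monic q by apply: (monic_pullback (pullback_sym K)).
have [h [h1 h2]] := pullback_lift K sq.
have [|r rP] := epic_subobject ee (split_monic (comp_idl (idm Q))) mq.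
  move=> V t; split=> _; last by exists (e ∘ t); rewrite comp_idl.
  by exists (h ∘ t); crw h2.
exists (p ∘ r); have e2 : m ∘ (p ∘ r) = b by crw sqK; rewrite rP comp_idr.
by split=> //; apply: mm; rewrite sq comp_assoc e2.
Qed.

Lemma balanced (A B : C) (m : A ~> B) : monic m -> epic m -> is_iso m.
Proof.
move=> mm em; have [_ H] := monic_strong mm.
have [|l [l1 l2]] := H _ _ m em (idm A) (idm B).
  by rewrite comp_idl comp_idr.
by exists l.
Qed.

(** If [f] and [g] agree after [q] and [m] is their equalizer, then [v] and [v ∘ m] have the same
    preimage along [d], so [m] has a section. *)
Lemma epic_pullback (Q X B Y : C) (d : X ~> Y) (v : B ~> Y) (p : Q ~> X)
    (q : Q ~> B) : epic d -> monic v -> is_pullback d v p q -> epic q.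
Proof.
move=> ed mv K Z f g e; have [sq _] := K.
have [E [m [mm [em mU]]]] := equalizer f g.
have [|r rP] := epic_subobject (m := v) (n := v ∘ m) ed mv (monic_comp mm mv).
  move=> V t; split=> -[s H]; last by exists (m ∘ s); crw H.
  have [h [h1 h2]] := pullback_lift K (eq_sym H).
  have [|s' s'P] := mU _ s; first by rewrite -h2 !comp_assoc e.
  by exists s'; norm; rewrite s'P.
have e1 : m ∘ r = idm B by apply: mv; norm; rewrite comp_assoc.
by rewrite -(comp_idr f) -(comp_idr g) -e1 !comp_assoc em.
Qed.

(** If [f] and [g] agree after [q], the names of their equalizer and of [B] agree over [A]. As [A]
    covers the terminal object, the names are equal. *)
Lemma epic_snd (A B Q : C) (p : Q ~> A) (q : Q ~> B) :
  epic (bang T A) -> is_product p q -> epic q.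
Proof.
move=> eA H Z f g e.
have [E [m [mm [em mU]]]] := equalizer f g.
have [k kP] := name mm.
have [|k' kP'] := @name _ _ (idm B); first by move=> V x y; rewrite !comp_idl.
have kk : k = k'.
  apply: eA; apply: mem_ext => V t x; norm; rewrite kP kP'.
  split=> _; first by exists x; rewrite comp_idl.
  apply: mU; have [h [[_ <-] _]] := H _ t x.
  by rewrite !comp_assoc e.
have [s sP] : exists s, m ∘ s = idm B.
  apply/(kP _ (bang T B)); rewrite kk; apply/kP'.
  by exists (idm B); rewrite comp_idl.
by rewrite -(comp_idr f) -(comp_idr g) -sP !comp_assoc em.
Qed.

(* The image of [f : X ~> Y] is cut out of [Y] by the condition that all pairs
   of subsets of [Y] with equal preimages in [X] agree. *)
Lemma image (X Y : C) (f : X ~> Y) :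
  exists (I : C) (e : X ~> I) (m : I ~> Y), epic e /\ monic m /\ f = m ∘ e.
Proof.
have [F FP] := preimage f.
have [I [i1 [i2 K]]] := pb F F.
have [sqK _] := K.
(* [s] and [t] send [y] to the set of pairs in [I] whose first, respectively second, subset contains
   [y]. *)
have [s sP] := transpose i1.
have [t tP] := transpose i2.
have [E [m [mm [em mU]]]] := equalizer s t.
have [|e eP] := mU _ f.
  apply: mem_ext => V w x; norm; rewrite sP tP -!FP.
  by crw sqK.
exists E, e, m; split=> // Z g h gh.
(* As [e] factors through [n], the subobjects [m] and [m ∘ n] both have all of [X] as preimage.
   Their names form a point [i] of [I], and [em] evaluated at [i] makes [m] factor through
   [m ∘ n]. *)
have [U [n [mn [en nU]]]] := equalizer g h.
have [e' e'P] := nU _ _ gh.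
have [k kP] := name mm.
have [k' kP'] := name (monic_comp mn mm).
have [|i [ik ik']] := @pullback_lift _ _ _ _ _ _ _ _ _ K _ k k'.
  apply: mem_ext => V w x; norm; rewrite !FP kP kP'; split=> _.
    by exists (e' ∘ x); crw e'P; crw eP.
  by exists (e ∘ x); crw eP.
have [r rP] : exists r, m ∘ n ∘ r = m.
  apply/(kP' _ (bang T E)); rewrite -ik' -comp_assoc -tP -em sP; crw ik.
  by apply/kP; exists (idm E); rewrite comp_idr.
have nr : n ∘ r = idm E by apply: mm; rewrite comp_idr comp_assoc.
by rewrite -(comp_idr g) -(comp_idr h) -nr !comp_assoc en.
Qed.

(* Powers turn the pushout into the pullback [I] of [power X] and [power B] over
   [power A]; the pushout is the image of [X] in [power I]. *)
Lemma pushout (A X B : C) (u : A ~> X) (a : A ~> B) : epic a ->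
  exists (Y : C) (c : X ~> Y) (v : B ~> Y), is_pushout u a c v.
Proof.
move=> ea; have [Pu PuP] := preimage u; have [Pa PaP] := preimage a.
have [I [i1 [i2 K]]] := pb Pu Pa.
have [sqK _] := K.
(* [x] and [b] send an element to the set of pairs in [I] whose first, respectively second, subset
   contains it. *)
have [x xP] := transpose i1.
have [b bP] := transpose i2.
have sq : x ∘ u = b ∘ a.
  apply: mem_ext => V w i; norm; rewrite xP bP -PuP -PaP.
  by crw sqK.
have [Y [c [m [ec [mm xE]]]]] := image x; subst x.
have [_ /(_ _ _ _ ea (c ∘ u) b)] := monic_strong mm.
rewrite comp_assoc => /(_ sq) [v [va mv]].
exists Y, c, v; split=> // W f g fg.
(* The fibres of [f] and [g] over [w] form a pair in [I], which gives [k]. Its preimage operation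
   [Pk] turns the image of an element [t] of [X] into the singleton of [f ∘ t], so the strong
   monomorphism [sg] yields the factorization through [c]. *)
have [sg [msg sgP]] := singleton W.
have [k1 k1P] := transpose (sg ∘ f).
have [k2 k2P] := transpose (sg ∘ g).
have [|k [kk1 kk2]] := @pullback_lift _ _ _ _ _ _ _ _ _ K _ k1 k2.
  apply: mem_ext => V w t; norm; rewrite PuP PaP k1P k2P -!comp_assoc !sgP.
  by rewrite comp_assoc fg -comp_assoc.
have [Pk PkP] := preimage k.
have [_ /(_ _ _ c ec f (Pk ∘ m))] := monic_strong msg.
case.
  apply: mem_ext => V t w; norm; rewrite PkP [m ∘ _]comp_assoc xP.
  by crw kk1; rewrite k1P -comp_assoc.
move=> h [hc _]; exists h; split; last first.
  by move=> h' [h'c _]; apply: ec; rewrite hc h'c.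
by split=> //; apply: ea; rewrite -comp_assoc va comp_assoc hc.
Qed.

(** The partial map [(u, a)], as a map from [X] to [power B], agrees on [A] with the singleton map
    of [B], so both extend to [k] on [Y]. Then [k ∘ v] is monic, and [c ∘ x = v ∘ b] puts [b] in the
    value of the partial map at [x]. *)
Lemma pushout_monic (A X B Y : C) (u : A ~> X) (a : A ~> B) (c : X ~> Y)
    (v : B ~> Y) :
  monic u -> is_pushout u a c v -> monic v /\ is_pullback c v u a.
Proof.
move=> mu [sq H].
have [g gP] := graph a mu.
have [sg [msg sgP]] := singleton B.
have [|k [[kc kv] _]] := H _ g sg.
  apply: mem_ext => V x b; norm; rewrite gP sgP; split.
    by move=> [s [/mu -> ->]].
  by move=> <-; exists x.
have mv : monic v.
  by move=> V h h' e; apply: msg; rewrite -kv -!comp_assoc e.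
split=> //; apply: pullbackI => // [V h h' /mu //|V x b xb].
apply/gP; rewrite -kc; crw xb; rewrite comp_assoc kv.
by apply/sgP.
Qed.

(* The kernel of [d'] lives over the image of [u']: if [F] is the fibre of [d']
   over a generalized point disjoint from [u'], then [z |-> {f | z = i f}]
   on [Z] is compatible with [y |-> {f | u' y = d' (i f)}] on [Y]. *)
Lemma pushout_fibre_monic (X Y Z W S F : C) (d : X ~> Y) (u : X ~> Z)
    (d' : Z ~> W) (u' : Y ~> W) (w : S ~> W) (i : F ~> Z) (q : F ~> S) :
  is_pushout d u u' d' -> monic w -> is_pullback d' w i q ->
  (forall (V : C) (y : V ~> Y) (s : V ~> S), u' ∘ y = w ∘ s ->
     forall (A : C) (f g : V ~> A), f = g) ->
  monic q.
Proof.
move=> [sq H] mw K disj; have [sqK _] := K.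
have mi := monic_pullback K mw.
have [sZ [_ sZP]] := singleton Z.
have [sW [_ sWP]] := singleton W.
have [sF [msF sFP]] := singleton F.
have [z zP] := transpose (sZ ∘ i).
have [y yP] := transpose (sW ∘ (d' ∘ i)).
have [|k [[_ kz] _]] := H _ (y ∘ u') z.
  apply: mem_ext => V t f; norm; rewrite zP yP -!comp_assoc sZP sWP; split.
    (* Where the two subsets could differ, the stage meets both [u'] and [w], and there all parallel
       maps coincide. *)
    move=> e; apply: (disj _ (d ∘ t) (q ∘ f)).
    by rewrite -e comp_assoc sqK -comp_assoc.
  by move=> ->; rewrite !comp_assoc sq.
(* An element of the fibre is thus recovered, as a singleton, from its image under [q]. *)
have kE : (k ∘ w) ∘ q = sF.
  rewrite -comp_assoc -sqK comp_assoc kz.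
  apply: mem_ext => V t f; norm; rewrite zP sFP -comp_assoc sZP.
  by split=> [/mi|->].
by move=> V f g e; apply: msF; rewrite -kE -!comp_assoc e.
Qed.

(* [M] is the object of pairs [(b, S)] of an element [b] of [B] and a subset [S]
   of [A] such that [S] is a singleton if [b = j] and empty otherwise. *)
Lemma universal_extension (A B : C) (j : T ~> B) : epic (bang T A) ->
  exists (M : C) (d : M ~> B) (u : A ~> M),
    epic d /\ is_pullback d j u (bang T A) /\
    forall (Q : C) (d' : Q ~> B) (u' : A ~> Q),
      is_pullback d' j u' (bang T A) ->
      exists! h : Q ~> M, h ∘ u' = u /\ d ∘ h = d'.
Proof.
move=> eA; have [sg [msg sgP]] := singleton A.
have [x xP] := characteristic (@point_monic _ _ _ j).
have [y yP] := characteristic msg.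
(* In [K], the first component is [j] exactly when the second is a singleton. *)
have [K [k1 [k2 HK]]] := pb x y.
have [sqK _] := HK.
(* [g] sends [S] to the set of all [a] with [S] the singleton of [a]; being fixed by [g] forces an
   [S] with a member to be a singleton. *)
have [g gP] := graph (idm A) msg.
have [M [n [mn [en nU]]]] := equalizer (g ∘ k2) k2.
set d := k1 ∘ n; set s := k2 ∘ n.
have jm : jointly_monic d s.
  move=> V h h' e1 e2; apply: mn; apply: (pullback_joint HK);
  by rewrite !comp_assoc.
(* [F1] and [F2] give the two properties of pairs in [M], and [F3] builds an element of [M] from a
   pair that has them. *)
have F1 V (c : V ~> M) : (exists t, j ∘ t = d ∘ c) <-> exists a, sg ∘ a = s ∘ c.
  by rewrite -(xP _ _ (bang T V)) -(yP _ _ (bang T V)) /d /s; crw sqK.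
have F2 V (c : V ~> M) a : mem (s ∘ c) a -> sg ∘ a = s ∘ c.
  by rewrite /s -{1}en -!comp_assoc gP; move=> [a' [<- <-]]; rewrite comp_idl.
have F3 V (b : V ~> B) (S : V ~> power A) :
    (forall (V' : C) (t : V' ~> V),
       (exists p, j ∘ p = b ∘ t) <-> exists a, sg ∘ a = S ∘ t) ->
    (forall (V' : C) (t : V' ~> V) a, mem (S ∘ t) a -> sg ∘ a = S ∘ t) ->
    exists c, d ∘ c = b /\ s ∘ c = S.
  move=> H1 H2; have [|k [kb kS]] := @pullback_lift _ _ _ _ _ _ _ _ _ HK V b S.
    by apply: mem_ext => V' t a; norm; rewrite xP yP.
  have [|c cP] := nU _ k.
    rewrite -comp_assoc kS; apply: mem_ext => V' t a; norm; rewrite gP; split.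
      by move=> [a' [<- <-]]; rewrite comp_idl; apply/sgP.
    by move=> /H2 e; exists a; rewrite comp_idl.
  by exists c; rewrite /d /s -!comp_assoc cP.
clearbody d s.
have [V t|V t a /sgP -> //|u [du su]] := F3 _ (j ∘ bang T A) sg.
  split=> _; first by exists t.
  by exists (bang T A ∘ t); rewrite comp_assoc.
have mu : monic u by move=> V f h e; apply: msg; rewrite -su -!comp_assoc e.
have univ (Q : C) (d' : Q ~> B) (u' : A ~> Q) :
    is_pullback d' j u' (bang T A) ->
    exists! h : Q ~> M, h ∘ u' = u /\ d ∘ h = d'.
  move=> H; have [sq _] := H.
  have mu' := monic_pullback H (@point_monic _ _ _ j).
  (* [S] sends [z] to the set of all [a] with [u' ∘ a = z]; paired with [d'] it gives [h]. *)
  have [S SP] := graph (idm A) mu'.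
  have Su : S ∘ u' = sg.
    apply: mem_ext => V t a; norm; rewrite SP sgP; split.
      by move=> [_ [/mu' -> <-]]; rewrite comp_idl.
    by move=> ->; exists a; rewrite comp_idl.
  have [V t|V t a|h [hd hS]] := F3 _ d' S.
      split.
      move=> [p pP]; have [a [ua _]] := pullback_lift H (eq_sym pP).
      by exists a; rewrite -ua comp_assoc Su.
    move=> [a aP]; have /SP [a' [<- _]] : mem (S ∘ t) a.
      by rewrite -aP; apply/sgP.
    by exists (bang T A ∘ a'); crw sq.
    by move=> /SP [a' [<- <-]]; rewrite comp_idl comp_assoc Su.
  exists h; split.
    by split=> //; apply: jm; [crw hd; rewrite du | crw hS; rewrite Su su].
  move=> h' [h'u h'd]; apply: jm; first by rewrite hd h'd.
  rewrite hS; apply: mem_ext => V t a; rewrite SP; split.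
    move=> [a' [<- <-]]; norm; rewrite [h' ∘ _]comp_assoc h'u.
    by rewrite comp_assoc su; apply/sgP.
  rewrite -comp_assoc => ha; have e := F2 _ _ _ ha.
  have [p pP] : exists p, j ∘ p = d ∘ (h' ∘ t) by apply/F1; exists a.
  have [|a' [ua' _]] := @pullback_lift _ _ _ _ _ _ _ _ _ H V t p.
    by rewrite pP comp_assoc h'd.
  exists a'; split=> //; rewrite comp_idl; apply: msg.
  by rewrite e -ua' [h' ∘ _]comp_assoc h'u comp_assoc su.
exists M, d, u; split; last split=> //.
  (* [d] is epic because the second projection of the product of [A] and [B], with [A] embedded over
     [j], factors through it. *)
  have [Q [p [q HQ]]] := binary_product A B.
  have [i [[pi qi] _]] := HQ _ (idm A) (j ∘ bang T A).
  have [|h [[_ hq] _]] := univ Q q i.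
    apply: pullbackI => // [V f f' e _|V z b e].
      by rewrite -(comp_idl f) -(comp_idl f') -pi -!comp_assoc e.
    exists (p ∘ z); split; last exact: terminal_eq.
      apply: (product_joint HQ); first by rewrite comp_assoc pi comp_idl.
      by rewrite e comp_assoc qi -comp_assoc; congr (_ ∘ _); apply: terminal_eq.
  by apply: (@epic_cancel _ _ _ _ h); rewrite hq; apply: (epic_snd eA HQ).
apply: pullbackI => [//|V f f' /mu //|V c b e].
have [a aP] : exists a, sg ∘ a = s ∘ c by apply/F1; exists b.
exists a; split; last exact: terminal_eq.
apply: jm; last by rewrite -aP; crw su.
by crw du; rewrite e; congr (_ ∘ _); apply: terminal_eq.
Qed.

(** [Z] is the truth value saying that every truth value is true. Over [Z] every monomorphism
    splits: for equalizers this identifies parallel maps, and for singletons pulled back along a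
    point of [power X] it gives a map to [X]. *)
Lemma strict_initial :
  exists Z : Initial C,
    forall (V : C) (t : V ~> Z) (A : C) (f g : V ~> A), f = g.
Proof.
have [n1 n1P] := name (split_monic (comp_idl (idm (power T)))).
have [tt ttP] := characteristic (split_monic (comp_idl (idm T))).
have [n2 n2P] := name (@point_monic _ _ _ tt).
have [Z [z [mz [ez _]]]] := equalizer n1 n2.
have split_mono (V : C) (t : V ~> Z) (A : C) (m : A ~> V) : monic m ->
    exists r, m ∘ r = idm V.
  move=> /characteristic [k kP]; apply/(kP _ _ (bang T V)).
  have : mem (n1 ∘ (z ∘ t)) k by apply/n1P; exists k; rewrite comp_idl.
  rewrite comp_assoc ez -comp_assoc => /n2P [s <-].
  by rewrite comp_idr; apply/ttP; exists s; rewrite comp_idl.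
have strict (V : C) (t : V ~> Z) (A : C) (f g : V ~> A) : f = g.
  have [E [m [mm [em _]]]] := equalizer f g.
  have [r rP] := split_mono V t E m mm.
  by rewrite -(comp_idr f) -(comp_idr g) -rP !comp_assoc em.
have cob (X : C) : inhabited (Z ~> X).
  have [sg [msg _]] := singleton X.
  have [k _] := name (split_monic (comp_idl (idm X))).
  have [D [p [q K]]] := pb sg (k ∘ z).
  have [r _] := split_mono Z (idm Z) D q (monic_pullback (pullback_sym K) msg).
  by constructor; exact: (p ∘ r).
have [cobang] := inhabited_forall cob.
exists (Build_Initial (fun X f => strict Z (idm Z) X f (cobang X))).
exact: strict.
Qed.

End Powers.

(** * Elementary toposes have power objects *)

Section Cospans.

Inductive cospan_ob := Lft | Rgt | Mid.

Definition cospan_hom (i j : cospan_ob) : Set :=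
  match i, j with
  | Lft, Lft | Rgt, Rgt | Mid, Mid | Lft, Mid | Rgt, Mid => unit
  | _, _ => Empty_set
  end.

Definition cospan_id (i : cospan_ob) : cospan_hom i i :=
  match i with Lft | Rgt | Mid => tt end.

Definition cospan_comp (i j k : cospan_ob) :
  cospan_hom j k -> cospan_hom i j -> cospan_hom i k.
Proof.
by case: i j k => [] [] [] g f; first [exact: tt | case: g | case: f].
Defined.

Definition cospan_cat : Category.
Proof.
apply: (@Build_Category cospan_ob cospan_hom cospan_id cospan_comp).
- by move=> [] [] [].
- by move=> [] [] [].
- by move=> [] [] [] [] [] [] [].
Defined.

Lemma cospan_finite : finite_category cospan_cat.
Proof.
split; first by exists (Lft :: Rgt :: Mid :: nil)%list; case=> /=; tauto.
by case; case; (exists (tt :: nil)%list + exists nil); case=> /=; tauto.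
Qed.

Variables (C : Category) (A B Z : C) (f : A ~> Z) (g : B ~> Z).

Definition cospan_functor_ob (i : cospan_cat) : C :=
  match i with Lft => A | Rgt => B | Mid => Z end.

Definition cospan_functor : Functor cospan_cat C.
Proof.
refine (@Build_Functor _ _ cospan_functor_ob
  (fun i j => match i, j return cospan_hom i j ->
       (cospan_functor_ob i ~> cospan_functor_ob j) with
   | Lft, Lft => fun _ => idm A
   | Rgt, Rgt => fun _ => idm B
   | Mid, Mid => fun _ => idm Z
   | Lft, Mid => fun _ => f
   | Rgt, Mid => fun _ => g
   | _, _ => fun e => match e with end
   end) _ _).
- by case.
- by do 3 case; case; case; rewrite /= ?comp_idl ?comp_idr.
Defined.

End Cospans.

Lemma finite_limits_pullbacks (C : Category) :
  has_finite_limits C -> has_pullbacks C.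
Proof.
move=> H A B Z f g.
have [L [pr [cone univ]]] := H _ cospan_finite (cospan_functor f g).
have eL : f ∘ pr Lft = pr Mid by exact: (cone Lft Mid tt).
have eR : g ∘ pr Rgt = pr Mid by exact: (cone Rgt Mid tt).
exists L, (pr Lft), (pr Rgt); split; first by rewrite eL eR.
move=> W a b e.
have [|h [hP hU]] := univ W (fun i => match i return
    (W ~> cospan_functor_ob A B Z i) with
  | Lft => a | Rgt => b | Mid => f ∘ a end).
  by case; case; case; rewrite /= ?comp_idl ?e.
exists h; split; first by split; [exact: (hP Lft) | exact: (hP Rgt)].
move=> h' [ha hb]; apply: hU; case=> //=.
by rewrite -eL -comp_assoc ha.
Qed.

(** The power object is the exponential of [Om] by [X], with membership the pullback of [tr] along
    [ev]. A relation is classified by the transpose of its characteristic map. *)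
Lemma topos_power_object (C : Category) (X : C) :
  elementary_topos C -> inhabited (power_object X).
Proof.
case=> /finite_limits_pullbacks pb hexp [T [Om [tr cls]]].
have [E [Q [p [q [ev [prodQ univ]]]]]] := hexp X Om.
have jQ := product_joint prodQ.
have [M [n [n' K]]] := pb _ _ _ ev tr.
have [sqK _] := K.
have mn : monic n := monic_pullback K (@point_monic _ _ _ tr).
have nP V (t : V ~> Q) : (exists s, n ∘ s = t) <-> ev ∘ t = tr ∘ bang T V.
  split=> [[s <-]|e].
    by crw sqK; congr (_ ∘ _); apply: terminal_eq.
  by have [s [sP _]] := pullback_lift K e; exists s.
have jM : jointly_monic (p ∘ n) (q ∘ n).
  by move=> V h h' e1 e2; apply: mn; apply: jQ; rewrite !comp_assoc.
constructor; apply: (@Build_power_object _ _ E M (p ∘ n) (q ∘ n) jM).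
move=> W R r1 r2 jR.
have [D [p' [q' prodD]]] := binary_product T pb W X.
have jD := product_joint prodD.
have [r [[r1P r2P] _]] := prodD _ r1 r2.
have mr : monic r.
  by move=> V h h' e; apply: jR; rewrite -?r1P -?r2P -!comp_assoc e.
have [chi [chiP chiU]] := cls _ _ _ mr.
(* The map [k] represents the relation [(r1, r2)] exactly when its transpose
   classifies [r]. *)
have key (k : W ~> E) (h : D ~> Q) : p ∘ h = k ∘ p' -> q ∘ h = q' ->
    (forall (V : C) (w : V ~> W) (x : V ~> X),
      (exists s, p ∘ n ∘ s = k ∘ w /\ q ∘ n ∘ s = x) <->
      (exists s, r1 ∘ s = w /\ r2 ∘ s = x)) <->
    is_pullback (ev ∘ h) tr r (bang T R).
  move=> hp hq.
  have mem1 V (t : V ~> D) : (ev ∘ (h ∘ t) = tr ∘ bang T V) <->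
      exists s, p ∘ n ∘ s = k ∘ (p' ∘ t) /\ q ∘ n ∘ s = q' ∘ t.
    rewrite -nP; split=> -[s].
      by move=> sP; exists s; crw sP; rewrite -hq; crw hp.
    move=> [s1 s2]; exists s; apply: jQ; rewrite !comp_assoc.
      by rewrite s1 hp comp_assoc.
    by rewrite s2 hq.
  have mem2 V (t : V ~> D) : (exists s, r ∘ s = t) <->
      exists s, r1 ∘ s = p' ∘ t /\ r2 ∘ s = q' ∘ t.
    split=> -[s]; first by move=> <-; exists s; rewrite !comp_assoc r1P r2P.
    move=> [s1 s2]; exists s; apply: jD; rewrite !comp_assoc.
      by rewrite r1P.
    by rewrite r2P.
  split=> H.
    apply: pullbackI => [|V f f' /mr //|V t b].
      rewrite -comp_assoc; apply/mem1/H/mem2.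
      by exists (idm R); rewrite comp_idr.
    rewrite -comp_assoc (terminal_eq b (bang T V)).
    by move=> /mem1/H/mem2 [s sP]; exists s; split=> //; exact: terminal_eq.
  move=> V w x; have [t [[<- <-] _]] := prodD _ w x.
  rewrite -mem1 -mem2 comp_assoc; case: (H) => sqH _; split=> [e|[s <-]].
    by have [s [sP _]] := pullback_lift H e; exists s.
  by crw sqH; congr (_ ∘ _); apply: terminal_eq.
have [k [[h [hp [hq hev]]] kU]] := univ _ _ _ _ prodD chi.
exists k; split; first by apply/(key k h hp hq); rewrite hev.
move=> k' k'P; apply: kU.
have [h' [[hp' hq'] _]] := prodQ _ (k' ∘ p') q'.
exists h'; split=> //; split=> //.
by apply: eq_sym; apply: chiU; apply/(key k' h' hp' hq').
Qed.

Lemma topos_power_objects (C : Category) :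
  elementary_topos C -> inhabited (forall X : C, power_object X).
Proof.
by move=> topos; apply: inhabited_forall => X; apply: topos_power_object.
Qed.

(** * Categories of elements over a topos *)

Section Opfibration.
Variables (D C : Category) (U : Functor D C).

(** An inductive family avoids equations between objects of [C]: case analysis replaces the codomain
    and the map by images under [U]. *)
Inductive lifts_from (X : D) : forall Z : C, (U X ~> Z) -> Prop :=
  Lifts_from (Z : D) (f : X ~> Z) : lifts_from (fmap U f).

Inductive span_lifts (X Y : D) : forall Q : C, (Q ~> U X) -> (Q ~> U Y) -> Prop :=
  Span_lifts (Q : D) (p : Q ~> X) (q : Q ~> Y) :
    span_lifts (fmap U p) (fmap U q).

(* Up to isomorphism, [U] is the projection of the category of elements of a
   functor from [C] to sets that is injective on monomorphisms. *)
Record elements_projection : Prop := {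
  faithful : forall (X Y : D) (f g : X ~> Y), fmap U f = fmap U g -> f = g;
  lift_from : forall (X : D) (Z : C) (f : U X ~> Z), lifts_from f;
  lift_factor : forall (X Y Z : D) (e : X ~> Y) (k : X ~> Z) (h : U Y ~> U Z),
    h ∘ fmap U e = fmap U k -> exists h' : Y ~> Z, fmap U h' = h;
  lift_monic : forall (X Y Z : D) (m : Y ~> Z) (k : X ~> Z) (h : U X ~> U Y),
    monic (fmap U m) -> fmap U m ∘ h = fmap U k ->
    exists h' : X ~> Y, fmap U h' = h
}.

(** [U T] is terminal; the maps are kept as data so that a [Terminal] structure on the object [U T]
    itself can be rebuilt. *)
Definition fmap_terminal (T : Terminal D) : Prop :=
  inhabited { b : forall V : C, V ~> U T | forall V (f : V ~> U T), f = b V }.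

Lemma fmap_terminal_transfer (T T' : Terminal D) :
  fmap_terminal T -> fmap_terminal T'.
Proof.
move=> [[b bU]].
constructor; exists (fun V => fmap U (bang T' T) ∘ b V) => V f.
rewrite -(bU V (fmap U (bang T T') ∘ f)) comp_assoc -fmap_comp.
by rewrite (terminal_eq (bang T' T ∘ bang T T') (idm T')) fmap_id comp_idl.
Qed.

(** [adm_span] serves (A3) and the fibres in (A5), [adm_point] the dichotomy of (A5),
    [adm_inhabited] the epimorphism of (A6). Disjointness in [adm_point] means that all parallel
    maps out of a common stage coincide. *)
Record admissible : Prop := {
  adm_elements : elements_projection;
  adm_terminal : exists T : Terminal D, fmap_terminal T;
  adm_span : forall (X B Y : D) (d : X ~> Y) (v : B ~> Y) (Q : C)
    (p : Q ~> U X) (q : Q ~> U B),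
    is_pullback (fmap U d) (fmap U v) p q -> epic q -> span_lifts p q;
  adm_point : forall (T : Terminal D) (B Y : D) (v : B ~> Y) (w : T ~> Y),
    monic (fmap U v) ->
    (exists b, v ∘ b = w) \/
    (forall (V : C) (y : V ~> U B) (s : V ~> U T),
       fmap U v ∘ y = fmap U w ∘ s -> forall (A : C) (f g : V ~> A), f = g);
  adm_inhabited : forall (T : Terminal C) (X : D), epic (bang T (U X))
}.

Hypothesis (adm : admissible) (pb : has_pullbacks C)
  (pow : forall X : C, power_object X).

Let el := adm_elements adm.

(** * Transfer of epimorphisms, monomorphisms, pullbacks and pushouts along [U] *)

Lemma fmap_square (X A B Z : D) (f : A ~> Z) (p : X ~> A) (g : B ~> Z)
    (q : X ~> B) :
  f ∘ p = g ∘ q <-> fmap U f ∘ fmap U p = fmap U g ∘ fmap U q.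
Proof.
rewrite -!fmap_comp; split=> [-> //|e]; exact: (faithful el e).
Qed.

Lemma epic_fmap (X Y : D) (d : X ~> Y) : epic d <-> epic (fmap U d).
Proof.
split=> ed Z f g; last first.
  by move=> /fmap_square /ed; apply: (faithful el).
case: (lift_from el f) g => {}Z {}f g; rewrite -fmap_comp => e.
have [g' gE] := lift_factor el (eq_sym e); subst g; congr (fmap U _).
by apply: ed; apply: (faithful el); rewrite e fmap_comp.
Qed.

(** Lifting the comparison [r] from [U Q] to the pullback in [C] places that pullback in [D]. The
    universal property of [Q] then gives a retraction [s] of [r]. *)
Lemma pullback_fmap (Q A B Z : D) (f : A ~> Z) (g : B ~> Z) (p : Q ~> A)
    (q : Q ~> B) :
  is_pullback f g p q ->
  is_pullback (fmap U f) (fmap U g) (fmap U p) (fmap U q).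
Proof.
move=> K; have [/fmap_square sq _] := K.
have [Q0 [p0 [q0 K0]]] := pb (fmap U f) (fmap U g).
have [r [pr qr]] := pullback_lift K0 sq.
case: (lift_from el r) p0 q0 K0 pr qr => {}Q0 {}r p0 q0 K0 pr qr.
have [p0' E] := lift_factor el pr; subst p0.
have [q0' E] := lift_factor el qr; subst q0.
have [/fmap_square sq0 _] := K0.
have [s [ps qs]] := pullback_lift K sq0.
have pr' : p0' ∘ r = p by apply: (faithful el); rewrite fmap_comp.
have qr' : q0' ∘ r = q by apply: (faithful el); rewrite fmap_comp.
have sr : s ∘ r = idm Q.
  by apply: (pullback_joint K); rewrite comp_assoc (ps, qs) (pr', qr') comp_idr.
have srU : fmap U s ∘ fmap U r = idm (U Q) by rewrite -fmap_comp sr fmap_id.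
apply: pullbackI => // [W h h' e1 e2|W a b e].
  have e : fmap U r ∘ h = fmap U r ∘ h'.
    by apply: (pullback_joint K0); rewrite !comp_assoc (pr, qr).
  by rewrite -(comp_idl h) -(comp_idl h') -srU -!comp_assoc e.
have [h [ha hb]] := pullback_lift K0 e.
by exists (fmap U s ∘ h); rewrite !comp_assoc -!fmap_comp ps qs.
Qed.

Lemma pullback_reflect (Q A B Z : D) (f : A ~> Z) (g : B ~> Z) (p : Q ~> A)
    (q : Q ~> B) :
  monic (fmap U p) ->
  is_pullback (fmap U f) (fmap U g) (fmap U p) (fmap U q) ->
  is_pullback f g p q.
Proof.
move=> mp K; apply: pullbackI => [|W h h' e1 e2|W a b /fmap_square e].
- by apply/fmap_square; case: K.
- by apply: (faithful el); apply: mp; rewrite -!fmap_comp e1.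
- have [h [ha hb]] := pullback_lift K e.
  have [h' E] := lift_monic el mp ha; subst h.
  by exists h'; split; apply: (faithful el); rewrite fmap_comp.
Qed.

Lemma monic_fmap (A B : D) (m : A ~> B) : monic m <-> monic (fmap U m).
Proof.
split=> [mm|mm W f g /fmap_square /mm]; last exact: (faithful el).
have /pullback_fmap K : is_pullback m m (idm A) (idm A).
  apply: pullbackI => // [W h h'|W a b /mm <-]; first by rewrite !comp_idl.
  by exists a; rewrite comp_idl.
move=> W f g e; have [h [<- <-]] := pullback_lift K e.
by [].
Qed.

(** The diagonal exists in [C], where monomorphisms are strong, and returns to [D] by
    [lift_monic]. *)
Lemma strong_fmap (A B : D) (m : A ~> B) : strong_monic m <-> monic (fmap U m).
Proof.
split=> [[/monic_fmap //]|mm]; split; first by apply/monic_fmap.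
move=> Q Q' e /epic_fmap ee a b /fmap_square sq.
have [T [[b' bU]]] := adm_terminal adm.
have [_ /(_ _ _ _ ee _ _ sq) [l [la lb]]] :=
  monic_strong (Build_Terminal bU) pb pow mm.
have [l' E] := lift_monic el mm lb; subst l.
by exists l'; split; apply: (faithful el); rewrite fmap_comp.
Qed.

Lemma pushout_fmap (S A B Q : D) (f : S ~> A) (g : S ~> B) (p : A ~> Q)
    (q : B ~> Q) :
  is_pushout f g p q <->
  is_pushout (fmap U f) (fmap U g) (fmap U p) (fmap U q).
Proof.
split=> -[/fmap_square sq H]; split=> // W a b.
  case: (lift_from el a) b => {}W {}a b; rewrite -fmap_comp => e.
  have [b' E] := lift_factor el (eq_sym e); subst b.
  move: e; rewrite fmap_comp => /fmap_square /H [h [[ha hb] hU]].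
  exists (fmap U h); split; first by rewrite -!fmap_comp ha hb.
  move=> h'' [ha' hb']; have [h' E] := lift_factor el ha'; subst h''.
  by congr (fmap U _); apply: hU; split; apply: (faithful el);
     rewrite fmap_comp.
move=> /fmap_square /H [h [[ha hb] hU]].
have [h' E] := lift_factor el ha; subst h.
exists h'; split; first by split; apply: (faithful el); rewrite fmap_comp.
by move=> k [ka kb]; apply: (faithful el); apply: hU; rewrite -!fmap_comp ka kb.
Qed.

Lemma terminal_fmap (T : Terminal D) : fmap_terminal T.
Proof.
by have [T' HT'] := adm_terminal adm; apply: fmap_terminal_transfer HT'.
Qed.

(** * The axioms, lifted from the topos *)

Lemma admissible_A2 : axiom_A2 D.
Proof.
move=> X Y f; have [T [[b bU]]] := adm_terminal adm.
have [I [e [m [ee [mm fE]]]]] := image (Build_Terminal bU) pb pow (fmap U f).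
case: (lift_from el e) m ee mm fE => {}I {}e m /epic_fmap ee mm fE.
have [m' E] := lift_factor el (eq_sym fE); subst m.
exists I, e, m'; split=> //; split; first by apply/strong_fmap.
by apply: (faithful el); rewrite fmap_comp.
Qed.

Lemma pullback_along_strong (X Y B : D) (d : X ~> Y) (v : B ~> Y) :
  epic d -> monic (fmap U v) ->
  exists (Q : D) (p : Q ~> X) (q : Q ~> B),
    epic q /\ monic (fmap U p) /\
    is_pullback (fmap U d) (fmap U v) (fmap U p) (fmap U q).
Proof.
move=> /epic_fmap ed mv; have [T [[b bU]]] := adm_terminal adm.
have [Q [p [q K]]] := pb (fmap U d) (fmap U v).
have epi_q := epic_pullback (Build_Terminal bU) pb pow ed mv K.
have mp := monic_pullback K mv.
have sp := adm_span adm K epi_q.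
case: sp K epi_q mp => {}Q {}p {}q K /epic_fmap epi_q mp.
by exists Q, p, q.
Qed.

Lemma admissible_A3 : axiom_A3 D.
Proof.
move=> X Y B d v ed /strong_fmap mv.
have [Q [p [q [epi_q [mp K]]]]] := pullback_along_strong ed mv.
by exists Q, p, q; split=> //; apply: pullback_reflect.
Qed.

Lemma admissible_A4 : axiom_A4 D.
Proof.
move=> A X B u a /strong_fmap mu /epic_fmap ea.
have [T [[b bU]]] := adm_terminal adm.
have [Y [c [v H]]] := pushout (Build_Terminal bU) pb pow (fmap U u) ea.
have [mv K] := pushout_monic pb pow mu H.
case: (lift_from el c) v H mv K => {}Y {}c v H mv K.
have [sq _] := H; rewrite -fmap_comp in sq.
have [v' E] := lift_factor el (eq_sym sq); subst v.
exists Y, c, v'; split; first by apply/pushout_fmap.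
by split; [apply/strong_fmap | apply: pullback_reflect].
Qed.

Lemma admissible_A5 (T : Terminal D) : axiom_A5 T.
Proof.
move=> X Y Z W d u d' u' [ed one_pt] /strong_fmap mu H.
have ed' := pushout_epic H ed.
split=> //.
have H' := proj1 (pushout_fmap _ _ _ _) (pushout_sym H).
have [mu' KU] := pushout_monic pb pow mu H'.
have K := pullback_reflect mu KU.
(* Points with a non-invertible fibre under [d'] come from such points of [d], of which there is at
   most one. *)
have factor (w : T ~> W) : ~ iso_over_point d' w ->
    exists y, u' ∘ y = w /\ ~ iso_over_point d y.
  move=> niso; case: (adm_point adm w mu') => [[y yE]|disj].
    exists y; split=> // -[F [p [q [KF iq]]]]; apply: niso.
    by exists F, (u ∘ p), q; split=> //; rewrite -yE; apply: pullback_paste K KF.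
  (* In the disjoint case the fibre over [w] maps to [T] by an epimorphism that is also monic, hence
     by an isomorphism. *)
  case: niso; have [[b bU]] := terminal_fmap T.
  pose TC := Build_Terminal bU.
  have mw : monic (fmap U w) := @point_monic _ TC _ _.
  have [F [i [q [epi_q [mi KF]]]]] := pullback_along_strong ed' mw.
  exists F, i, q; split; first exact: pullback_reflect.
  have mq : monic (fmap U q).
    refine (pushout_fibre_monic pb pow (proj1 (pushout_fmap _ _ _ _) H) mw KF disj).
  have [g [g1 g2]] := balanced TC pb pow mq (proj1 (epic_fmap q) epi_q).
  have [|g' E] := @lift_monic el _ _ _ q (idm T) g mq; first by rewrite fmap_id.
  by subst g; exists g'; split; apply: (faithful el); rewrite fmap_comp fmap_id.
move=> w1 w2 /factor [y1 [<- n1]] /factor [y2 [<- n2]].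
by rewrite (one_pt _ _ n1 n2).
Qed.

Lemma admissible_A6 (T : Terminal D) : axiom_A6 T.
Proof.
move=> A B j; have [[b bU]] := terminal_fmap T.
pose TC := Build_Terminal bU.
have bE X : fmap U (bang T X) = bang TC (U X) by apply: bU.
have [M [d [u [ed [K univ]]]]] :=
  universal_extension pb pow (fmap U j : TC ~> U B) (@adm_inhabited adm TC A).
have mu := monic_pullback K (@point_monic _ TC _ (fmap U j)).
(* Lifting [u] from [A] turns [M] into an object of [D]; [d] then lifts because [d ∘ u] does. *)
case: (lift_from el u) d ed K univ mu => {}M {}u d ed K univ mu.
have [sq _] := K; rewrite -bE -fmap_comp in sq.
have [d' E] := lift_factor el sq; subst d.
rewrite -bE in K.
pose X0 := Build_fact_ob (proj2 (strong_fmap u) mu) (proj2 (epic_fmap d') ed)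
  (pullback_reflect mu K).
have hom (X : fact_cat A j) : exists f : X ~> X0, forall g, g = f.
  case: X => Q dQ uQ suQ edQ KQ.
  have := pullback_fmap KQ; rewrite bE => /univ [h [[hu hd] hU]].
  have [h' E] := lift_factor el hu; subst h.
  have hP : h' ∘ uQ = u /\ d' ∘ h' = dQ.
    by split; apply: (faithful el); rewrite fmap_comp.
  exists (exist _ h' hP) => -[g [g1 g2]]; apply: eq_sig_hprop.
    by move=> *; apply: proof_irrelevance.
  apply: (faithful el); apply: eq_sym; apply: hU.
  by rewrite -!fmap_comp /= g1 g2.
constructor; pose f X := constructive_indefinite_description _ (hom X).
exact: (@Build_Terminal (fact_cat A j) X0 (fun X => proj1_sig (f X))
  (fun X g => proj2_sig (f X) g)).
Qed.

Lemma admissible_axioms : satisfies_axioms D.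
Proof.
split.
- by have [T _] := adm_terminal adm; constructor.
- exact: admissible_A2.
- exact: admissible_A3.
- exact: admissible_A4.
- exact: admissible_A5.
- exact: admissible_A6.
Qed.

End Opfibration.

(** * Pointed and inhabited objects *)

Section PointedObjects.
Variables (C : Category) (T : Terminal C).

Definition pointed_forget : Functor (pointed_category T) C :=
  @Build_Functor (pointed_category T) C (@pcarrier C T)
    (fun X Y f => proj1_sig f) (fun X => eq_refl) (fun X Y Z g f => eq_refl).

Lemma pointed_eq (X Y : pointed_category T) (f g : X ~> Y) :
  proj1_sig f = proj1_sig g -> f = g.
Proof. by apply: eq_sig_hprop => *; apply: proof_irrelevance. Qed.

Lemma pointed_zeroP (X Y : pointed_category T) :
  ppoint Y ∘ bang T (pcarrier X) ∘ ppoint X = ppoint Y.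
Proof.
by rewrite -comp_assoc (terminal_eq (_ ∘ ppoint X) (idm T)) comp_idr.
Qed.

Definition pointed_zero (X Y : pointed_category T) : X ~> Y :=
  exist (fun f => f ∘ ppoint X = ppoint Y) _ (pointed_zeroP X Y).

Lemma pointed_admissible : admissible pointed_forget.
Proof.
split.
- split.
  + exact: pointed_eq.
  + move=> X Z f.
    exact: (@Lifts_from _ _ pointed_forget X
      (Build_pointed_ob (f ∘ ppoint X)) (exist _ f eq_refl)).
  + move=> X Y Z [e eP] [k kP] h /= hk.
    have hP : h ∘ ppoint Y = ppoint Z by rewrite -eP comp_assoc hk.
    by exists (exist _ h hP).
  + move=> X Y Z [m mP] [k kP] h /= mm hk.
    have hP : h ∘ ppoint X = ppoint Y.
      by apply: mm; rewrite comp_assoc hk kP mP.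
    by exists (exist _ h hP).
- pose one_pt : pointed_category T := Build_pointed_ob (idm T).
  have bP (X : pointed_category T) : bang T (pcarrier X) ∘ ppoint X = idm T.
    exact: terminal_eq.
  have bU (X : pointed_category T) (f : X ~> one_pt) : f = exist _ _ (bP X).
    by apply: pointed_eq; apply: terminal_eq.
  exists (Build_Terminal bU).
  by constructor; exists (bang T) => V f; apply: terminal_eq.
- move=> X B Y [d dP] [v vP] Q p q K _.
  (* The base points of [X] and [B] agree in [Y], so they give the base point of [Q]. *)
  have [x [px qx]] := pullback_lift K (eq_trans dP (eq_sym vP)).
  exact: (@Span_lifts _ _ pointed_forget _ _ (Build_pointed_ob x)
    (exist _ p px) (exist _ q qx)).
- move=> T' B Y [v vP] [w wP] _; left.
  exists (pointed_zero T' B); apply: pointed_eq => /=.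
  (* For any terminal pointed object the zero endomorphism is the identity, so [w] is itself the
     zero morphism. *)
  have kE : pointed_zero T' T' = idm T' by apply: terminal_eq.
  have {}kE : ppoint (one T') ∘ bang T (pcarrier (one T')) = idm _ :=
    f_equal (@proj1_sig _ _) kE.
  by rewrite comp_assoc vP -wP -comp_assoc kE comp_idr.
- move=> T' X V f g e.
  have bx : bang T' (pcarrier X) ∘ (ppoint X ∘ bang T T') = idm T'.
    exact: terminal_eq.
  by rewrite -(comp_idr f) -(comp_idr g) -bx !comp_assoc e.
Qed.

End PointedObjects.

Section InhabitedObjects.
Variable C : Category.

Let I : Category := full_subcategory (@inhabited_object C).

Definition inhabited_inclusion : Functor I C :=
  @Build_Functor I C (@proj1_sig _ _) (fun X Y f => f)
    (fun X => eq_refl) (fun X Y Z g f => eq_refl).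

(** Inhabitedness refers to some terminal object; the isomorphism between terminal objects carries
    it to all of them. *)
Lemma inhabited_bang (X : C) :
  inhabited_object X -> forall T : Terminal C, epic (bang T X).
Proof.
move=> [T' e] T V f g H.
have bb : bang T T' ∘ bang T' T = idm T by apply: terminal_eq.
have bX : bang T T' ∘ bang T' X = bang T X by apply: bang_unique.
rewrite -(comp_idr f) -(comp_idr g) -bb !comp_assoc; congr (_ ∘ _).
by apply: e; rewrite -!comp_assoc bX.
Qed.

Lemma inhabited_codomain (X Y : C) (f : X ~> Y) :
  inhabited_object X -> inhabited_object Y.
Proof.
move=> [T e]; exists T; apply: (@epic_cancel _ _ _ _ f).
by rewrite (bang_unique (_ ∘ f)).
Qed.

Lemma inhabited_admissible (T : Terminal C) : elementary_topos C ->
  two_valued C -> admissible inhabited_inclusion.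
Proof.
move=> topos two.
have pb := finite_limits_pullbacks (topos_limits topos).
have [pow] := topos_power_objects topos.
have [Z strict] := strict_initial T pb pow.
have iT : inhabited_object T.
  by exists T; rewrite (terminal_eq (bang T T) (idm T)) => V f g; rewrite !comp_idr.
pose TI := @Build_Terminal I (exist _ (T : C) iT)
  (fun X => bang T (proj1_sig X)) (fun X f => bang_unique f).
have bTI : fmap_terminal inhabited_inclusion TI.
  by constructor; exists (bang T) => V f; apply: terminal_eq.
split.
- split=> //.
  + move=> [X iX] Z' f.
    exact: (@Lifts_from _ _ inhabited_inclusion (exist _ X iX)
      (exist _ Z' (inhabited_codomain f iX)) f).
  + by move=> X Y Z' e k h _; exists h.
  + by move=> X Y Z' e k h _ _; exists h.
- by exists TI.
- move=> X B Y d v Q p q K epi_q.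
  have iQ : inhabited_object Q.
    have [TB e] := proj2_sig B; exists TB.
    by rewrite -(bang_unique (bang TB _ ∘ q)); apply: epic_comp.
  exact: (@Span_lifts _ _ inhabited_inclusion X B (exist _ Q iQ) p q).
- move=> T' B Y v w mv.
  have [[b bU]] := fmap_terminal_transfer T' bTI.
  pose TC := Build_Terminal bU.
  have [Q [p [q K]]] := pb _ _ _ (v : proj1_sig B ~> proj1_sig Y)
    (w : TC ~> proj1_sig Y).
  have [sq _] := K.
  have mq : monic q := monic_pullback (pullback_sym K) mv.
  (* The part of the point [w] lying in [B] is a subobject of 1. If it is 0, a common stage maps to
     the strict initial object; if it is 1, the inverse [j] gives the point of [B]. *)
  case: (two TC Z Q q mq) => -[i [[j [ji ij]] iE]].
  + right=> V y s e; have [h _] := pullback_lift K e.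
    exact: strict (i ∘ h).
  + left; exists (p ∘ j); rewrite /= comp_assoc sq -iE comp_idl -comp_assoc ij.
    exact: comp_idr.
- by move=> T' X; apply: inhabited_bang; exact: proj2_sig X.
Qed.

End InhabitedObjects.

Theorem theorem4p8 :
  (forall C : Category, elementary_topos C ->
     forall T : Terminal C, satisfies_axioms (pointed_category T))
  /\
  (forall C : Category, elementary_topos C -> nondegenerate C -> two_valued C ->
     satisfies_axioms (full_subcategory (@inhabited_object C))).
Proof.
split=> [C topos T|C topos _ two].
- have pb := finite_limits_pullbacks (topos_limits topos).
  have [pow] := topos_power_objects topos.
  exact: (admissible_axioms (pointed_admissible T) pb pow).
- have pb := finite_limits_pullbacks (topos_limits topos).
  have [pow] := topos_power_objects topos.
  have [T _] := topos_classifier topos.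
  exact: (admissible_axioms (inhabited_admissible T topos two) pb pow).
Qed.
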